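(* For every $n\ge2$, with $N_n=M_n(S_7)\setminus\{[1]_n\}$, $$N_n^3=\{[\infty]_n\}\cup\{E_{I,J}:\varnothing\ne I,J\subseteq[n],\ (I,J)\ne([n],[n])\},$$ $$N_n^4=\{[\infty]_n\}\cup\{E_{I,J}:\varnothing\ne I,J\subsetneq[n]\},$$ $$N_n^5=\{[\infty]_n\}.$$ Consequently, $$|N_n^3|=(2^n-1)^2,\qquad |N_n^4|=(2^n-2)^2+1.$$ In particular, the multiplicative reduct of $N_n$ is $5$-nilpotent but not $4$-nilpotent.
   Context: $S_7=\{1,a,\infty\}$ is the additively idempotent semiring with addition $x+x=x$ and $x+y=\infty$ for $x\ne y$, and with commutative multiplication $1\cdot 1=1$, $1\cdot a=a\cdot 1=a$, $a\cdot a=\infty$, $x\cdot\infty=\infty\cdot x=\infty$. $M_n(S_7)$ is the semiring of all $n\times n$ matrices over $S_7$ with entrywise addition and usual matrix multiplication $(AB)_{ij}=\sum_{k}A_{ik}B_{kj}$. $[n]=\{1,\dots,n\}$, and for $s\in S_7$, $[s]_n$ is the constant $n\times n$ matrix all of whose entries equal $s$. $N_n$ is closed under multiplication, and $N_n^k$ denotes the set of all products $A_1A_2\cdots A_k$ with $A_1,\dots,A_k\in N_n$. For nonempty $I,J\subseteq[n]$, $E_{I,J}$ is the $n\times n$ matrix with $(E_{I,J})_{rs}=a$ if $r\in I$ and $s\in J$, and $(E_{I,J})_{rs}=\infty$ otherwise. A semigroup with zero is $k$-nilpotent if every product of $k$ of its elements is the zero; the zero of $N_n$ is $[\infty]_n$.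 *)

(* Defs.v *)
From HB Require Import structures.
From mathcomp Require Import all_boot all_algebra.

Set Implicit Arguments.
Unset Strict Implicit.
Unset Printing Implicit Defensive.

Import GRing.Theory.
Local Open Scope group_scope.

Inductive S7 : Type := S7_1 | S7_a | S7_oo.

Definition S7_code (x : S7) : option bool :=
  match x with S7_1 => Some true | S7_a => Some false | S7_oo => None end.

Definition S7_decode (o : option bool) : S7 :=
  match o with Some true => S7_1 | Some false => S7_a | None => S7_oo end.

Lemma S7_codeK : cancel S7_code S7_decode.
Proof. by case. Qed.

HB.instance Definition _ := Finite.copy S7 (can_type S7_codeK).

Definition S7_add (x y : S7) : S7 := if x == y then x else S7_oo.

Definition S7_mul (x y : S7) : S7 :=
  match x, y with
  | S7_1, z | z, S7_1 => z
  | _, _ => S7_oo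
  end.

Lemma S7_addC : commutative S7_add.
Proof. by case; case. Qed.

Lemma S7_addA : associative S7_add.
Proof. by case; case; case. Qed.

Lemma S7_addxx : idempotent_op S7_add.
Proof. by case. Qed.

Lemma S7_mulC : commutative S7_mul.
Proof. by case; case. Qed.

Lemma S7_mulA : associative S7_mul.
Proof. by case; case; case. Qed.

Lemma S7_mul1x : left_id S7_1 S7_mul.
Proof. by case. Qed.

Lemma S7_mulx1 : right_id S7_1 S7_mul.
Proof. by case. Qed.

Lemma S7_mulDl : left_distributive S7_mul S7_add.
Proof. by case; case; case. Qed.

Lemma S7_mulDr : right_distributive S7_mul S7_add.
Proof. by case; case; case. Qed.

(* S7 has no additive identity, hence is not a semiring in the sense of ssralg,
   and the matrix product of the library does not apply.  Sums over 'I_n are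
   computed in S7 with an identity None adjoined; the default value is only
   reached by the empty sum, i.e., for n = 0. *)
Definition S7_sum n (F : 'I_n -> S7) : S7 :=
  odflt S7_oo (\big[oAC S7_addA S7_addC/None]_(k < n) Some (F k)).

Definition S7_mulmx n (A B : 'M[S7]_n) : 'M[S7]_n :=
  \matrix_(i, j) S7_sum (fun k => S7_mul (A i k) (B k j)).

Lemma S7_sumE n (F : 'I_n -> S7) : 0 < n ->
  Some (S7_sum F) = \big[oAC S7_addA S7_addC/None]_(k < n) Some (F k).
Proof.
case: n F => // n F _; rewrite /S7_sum big_ord_recl.
by case: (\big[_/_]_(i < n) _).
Qed.

Lemma S7_omap_sum n (f : S7 -> S7) (F : 'I_n -> S7) :
  {morph f : x y / S7_add x y} ->
  omap f (\big[oAC S7_addA S7_addC/None]_(k < n) Some (F k)) =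
  \big[oAC S7_addA S7_addC/None]_(k < n) Some (f (F k)).
Proof.
by move=> fD; apply: (big_morph (omap f)) => // - [x|] [y|] //=; rewrite /oAC /= fD.
Qed.

Lemma S7_mulmxA n : associative (@S7_mulmx n).
Proof.
case: n => [|n] A B C; first by apply/matrixP => - [].
apply/matrixP => i l; rewrite !mxE; apply: Some_inj; rewrite !S7_sumE //.
under eq_bigr => j _.
  rewrite mxE (_ : Some _ = omap (S7_mul (A i j)) (Some (S7_sum
    (fun k => S7_mul (B j k) (C k l))))) // S7_sumE // S7_omap_sum; last first.
    exact: S7_mulDr.
  over.
rewrite exchange_big /=; apply: eq_bigr => k _.
rewrite mxE -[Some _]/(omap (S7_mul^~ (C k l)) (Some (S7_sum
    (fun j => S7_mul (A i j) (B j k))))) S7_sumE // S7_omap_sum; last first.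
  by move=> x y; exact: S7_mulDl.
by apply: eq_bigr => j _; rewrite S7_mulA.
Qed.

(* An alias of 'M[S7]_n carrying the multiplicative semigroup structure; for the
   type 'M[_]_n itself the library reserves the product _ * _ of group_scope
   for matrix addition. *)
Definition MS7 n : Type := 'M[S7]_n.

HB.instance Definition _ n := Finite.on (MS7 n).
HB.instance Definition _ n := isSemigroup.Build (MS7 n) (@S7_mulmxA n).

Definition Cmx n (s : S7) : MS7 n := const_mx s.

Definition Nset n : {set MS7 n} := ~: [set Cmx n S7_1].

Lemma S7_sum_eq1 n (F : 'I_n -> S7) : 0 < n ->
  S7_sum F = S7_1 -> forall k, F k = S7_1.
Proof.
move=> n0 F1 k; move: (congr1 Some F1).
rewrite S7_sumE // (bigD1 k) //=; case: (\big[_/_]_(i < n | _) _) => [y|].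
  by rewrite oACE => - []; case: (F k); case: y.
by case.
Qed.

Lemma Nset_mulg_closed n : mulg_closed (mem (Nset n)).
Proof.
move=> A B; rewrite !inE => nA _; apply: contra nA => /eqP/matrixP AB1.
apply/eqP/matrixP => i j; have n0 : 0 < n by apply: leq_ltn_trans (ltn_ord i).
have := AB1 i i; rewrite !mxE => /(S7_sum_eq1 n0)/(_ j).
by case: (A i j); case: (B j i).
Qed.

Definition Nsub n : Type := {A : MS7 n | A \in Nset n}.

HB.instance Definition _ n := SubChoice.on (Nsub n).
HB.instance Definition _ n :=
  SubChoice_isSubSemigroup.Build _ _ (Nsub n) (@Nset_mulg_closed n).

(* The product of a nonempty sequence; a semigroup has no empty product. *)
Definition sgprod (G : semigroupType) (s : seq G) : option G :=
  if s is x :: s' then Some (foldl *%g x s') else None.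

Definition Npow n k : {set MS7 n} :=
  [set A | [exists t : k.-tuple (MS7 n),
    all (mem (Nset n)) t && (sgprod t == Some A)]].

Definition is_zero (G : semigroupType) (z : G) : Prop :=
  forall x : G, z * x = z /\ x * z = z.

Definition nilpotent_sg (G : semigroupType) (k : nat) : Prop :=
  exists2 z : G, is_zero z & forall t : k.-tuple G, sgprod t = Some z.

Definition Emx n (I J : {set 'I_n}) : MS7 n :=
  (\matrix_(r, s) if (r \in I) && (s \in J) then S7_a else S7_oo)%R.

(* Main.v *)
Require Import Defs.
From mathcomp Require Import all_boot all_algebra.

Set Implicit Arguments.
Unset Strict Implicit.
Unset Printing Implicit Defensive.

(** Each entry of a product of k matrices is a sum, over the paths of length k
    between its two indices, of the products of the entries met on the way, and
    a sum in S7 equals s <> oo only if all its summands equal s.  So an entry is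
    a when every path meets exactly one a and otherwise only 1's, and it is 1
    when every path meets only 1's.

    Let B be a matrix with an entry other than 1.  If an entry (i, j) of A B C
    is a, then every path through a fixed non-1 entry B p0 q0 meets its single a
    there, and comparison with the paths sharing one end of this edge shows that
    row i of A and column j of C are determined by B alone.  Hence the set of indices (i, j)
    where A B C equals a is a rectangle I x J ([mulg3_rectangle]), and, as no
    entry can be 1, the product is E_{I,J}, or constantly oo when I or J is
    empty.  The full rectangle is excluded: A and C would both have an entry a,
    and some path would meet both ([mulg3_not_a]).  All other rectangles are
    reached by explicit products ([rowmx_mul_colmx]).

    The higher powers follow by multiplying on the right by one more matrix.
    A row of E_{I,J} with index in I is a on J and oo elsewhere, so E_{I,J} B is
    constantly oo if J is proper ([Emx_mul_oo]), and if J = [n] it is E_{I,J'},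
    where J' is the set of the columns of B made of 1's only ([Emx_setT_mul]).
    Hence both index sets are proper in the fourth power, and the fifth is
    reduced to the zero.  The cardinalities follow as E is injective on pairs of
    nonempty sets, and k-nilpotency says that the k-th power is reduced to the
    zero ([nilpotent_sgP]). *)

(** * Entries of matrix products *)

Section Products.
Local Open Scope group_scope.

(** In the semilattice (S7, +) the elements 1 and a are minimal and oo is the
    join of any two distinct elements. *)
Lemma S7_sumP n (F : 'I_n -> S7) s : 0 < n -> s != S7_oo ->
  S7_sum F = s <-> forall k, F k = s.
Proof.
case: n F => // n F _ sN; split=> [Fs k|Fs].
  have := congr1 Some Fs; rewrite S7_sumE // (bigD1 k) //=.
  case: (\big[_/_]_(i < _ | _) _) => [y|]; last by case.
  by rewrite oACE => - []; case: (F k); case: y; case: s sN {Fs}.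
apply: Some_inj; rewrite S7_sumE // (eq_bigr (fun=> Some s)) => [|k _]; last by rewrite Fs.
rewrite big_const_ord; by elim: n {F Fs} => //= n ->; rewrite oACE S7_addxx.
Qed.

Lemma S7_mul_suml n (F : 'I_n -> S7) y : 0 < n ->
  S7_mul (S7_sum F) y = S7_sum (fun k => S7_mul (F k) y).
Proof.
move=> n0; apply: Some_inj.
rewrite -[LHS]/(omap (S7_mul^~ y) (Some (S7_sum F))) !S7_sumE //.
by apply: S7_omap_sum => u v; exact: S7_mulDl.
Qed.

Lemma S7_mul0x x : S7_mul S7_oo x = S7_oo. Proof. by case: x. Qed.

Variable n : nat.
Implicit Types (A B C : MS7 n) (I J : {set 'I_n}).

Lemma mulg_entryP A B i j s : s != S7_oo ->
  (A * B) i j = s <-> forall k, S7_mul (A i k) (B k j) = s.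
Proof. by rewrite mxE; apply: S7_sumP; apply: leq_ltn_trans (ltn_ord i). Qed.

Lemma mulg3_entryP A B C i j s : s != S7_oo ->
  (A * B * C) i j = s <->
  forall p q, S7_mul (S7_mul (A i p) (B p q)) (C q j) = s.
Proof.
have n0 : 0 < n by apply: leq_ltn_trans (ltn_ord i).
move=> sN; split=> [/mulg_entryP-/(_ sN) H p q|H].
  by move: (H q); rewrite mxE S7_mul_suml // => /S7_sumP; exact.
by apply/mulg_entryP => // q; rewrite mxE S7_mul_suml //; apply/S7_sumP.
Qed.

Lemma mulg_entry_oo A B i j k :
  S7_mul (A i k) (B k j) = S7_oo -> (A * B) i j = S7_oo.
Proof.
move=> ABk; apply/eqP/negPn/negP => ABN.
have /mulg_entryP-/(_ ABN k) := erefl ((A * B) i j); rewrite ABk => ABij.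
by rewrite -ABij in ABN.
Qed.

Lemma NsetP A : reflect (exists i j, A i j <> S7_1) (A \in Nset n).
Proof.
rewrite !inE; apply: (iffP idP) => [nA|[i [j]] Aij]; last first.
  by apply/eqP => A1; apply: Aij; rewrite A1 mxE.
have [/existsP[i /existsP[j /eqP Aij]]|] := boolP [exists i, exists j, A i j != S7_1].
  by exists i, j.
move=> A1; case/eqP: nA; apply/matrixP => i j; rewrite mxE.
by move: A1; rewrite negb_exists => /forallP/(_ i); rewrite negb_exists
  => /forallP/(_ j)/negPn/eqP.
Qed.

(** * Powers as sets of products *)

Lemma sgprod_rcons (G : semigroupType) (s : seq G) x : s != [::] ->
  sgprod (rcons s x) = omap (fun y => y * x) (sgprod s).
Proof. by case: s => // y s _; rewrite rcons_cons /= -cats1 foldl_cat. Qed.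

Lemma NpowP k A : reflect
  (exists s, [/\ size s = k, all (mem (Nset n)) s & sgprod s = Some A])
  (A \in Npow n k).
Proof.
rewrite inE; apply: (iffP idP) => [/existsP[t /andP[tN /eqP tA]]|[s [sk sN sA]]].
  by exists t; rewrite size_tuple.
apply/existsP.
by exists (tcast sk (in_tuple s)); rewrite val_tcast /= sN sA /=.
Qed.

Lemma Npow1 : Npow n 1 = Nset n.
Proof.
apply/setP => A; apply/NpowP/idP => [[s]|AN].
  by case: s => [|x [|y s]] [] //= _ /andP[xN _] [<-].
by exists [:: A]; rewrite /= andbT.
Qed.

Lemma NpowS k :
  Npow n k.+2 = [set A * B | A : MS7 n in Npow n k.+1, B : MS7 n in Nset n].
Proof.
apply/setP => M; apply/NpowP/imset2P => [[s]|[A B]].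
  case/lastP: s => [|s y] []; first by [].
  rewrite size_rcons all_rcons => - [sk] /andP[/= yN sN].
  rewrite sgprod_rcons; last by case: s sk {sN}.
  case sA: (sgprod s) => [A|] // [<-]; exists A y => //.
  by apply/NpowP; exists s.
case/NpowP=> s [sk sN sA] BN ->; exists (rcons s B).
rewrite size_rcons sk all_rcons /= BN sN sgprod_rcons ?sA //.
by case: s sk {sN sA}.
Qed.

Lemma Cmx_oo_mul A : Cmx n S7_oo * A = Cmx n S7_oo.
Proof.
apply/matrixP => i j; rewrite [RHS]mxE; apply: (@mulg_entry_oo _ _ _ _ i).
by rewrite mxE S7_mul0x.
Qed.

Lemma mul_Cmx_oo A : A * Cmx n S7_oo = Cmx n S7_oo.
Proof.
apply/matrixP => i j; rewrite [RHS]mxE; apply: (@mulg_entry_oo _ _ _ _ i).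
by rewrite [Cmx _ _ _ _]mxE S7_mulC S7_mul0x.
Qed.

Lemma Cmx_oo_Nset : 0 < n -> Cmx n S7_oo \in Nset n.
Proof. by move=> n0; apply/NsetP; exists (Ordinal n0), (Ordinal n0); rewrite mxE. Qed.

Lemma Cmx_oo_Npow k : 0 < n -> Cmx n S7_oo \in Npow n k.+1.
Proof.
move=> n0; have ooN := Cmx_oo_Nset n0.
elim: k => [|k IH]; first by rewrite Npow1.
by rewrite NpowS; apply/imset2P; exists (Cmx n S7_oo) (Cmx n S7_oo); rewrite ?Cmx_oo_mul.
Qed.

(** * The third power *)

(** A path from i to j through a non-1 entry B p0 q0 meets its only a there, so
    A i p0 = 1 = C q0 j, and likewise from i' to j'.  Cancelling 1 in the
    products along (i, p, q0, j) and (i', p, q0, j') leaves A i p * B p q0 = a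
    and A i' p * B p q0 = a, whence A i p = A i' p: rows i and i' of A agree. *)
Lemma mulg3_rectangle A B C i j i' j' : B \in Nset n ->
  (A * B * C) i j = S7_a -> (A * B * C) i' j' = S7_a ->
  (A * B * C) i j' = S7_a.
Proof.
case/NsetP=> p0 [q0 B0] /mulg3_entryP-/(_ isT) M /mulg3_entryP-/(_ isT) M'.
apply/mulg3_entryP => // p q; rewrite -(M' p q); congr (S7_mul (S7_mul _ _) _).
(* What remains is A i p = A i' p, read off from these four paths. *)
move: (M p q0) (M' p q0) (M p0 q0) (M' p0 q0) B0.
by case: (A i p); case: (A i' p); case: (B p q0); case: (C q0 j);
  case: (C q0 j') => //; case: (B p0 q0) => //; case: (A i p0) => //; case: (A i' p0).
Qed.

Lemma mulg3_neq1 A B C i j : B \in Nset n -> (A * B * C) i j <> S7_1.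
Proof.
case/NsetP=> p [q B0] /mulg3_entryP-/(_ isT p q).
by move: B0; case: (A i p); case: (B p q); case: (C q j).
Qed.

(** All entries of the three factors would be 1 or a, so that A and C, not being
    constantly 1, would each have an entry a, and a path through both of them
    has product oo. *)
Lemma mulg3_not_a A B C : A \in Nset n -> C \in Nset n ->
  ~ forall i j, (A * B * C) i j = S7_a.
Proof.
case/NsetP=> i [p Aip] /NsetP[q [j Cqj]] M.
have H p' q' : S7_mul (S7_mul (A i p') (B p' q')) (C q' j) = S7_a.
  by move/mulg3_entryP: (M i j); exact.
by move: (H p q) Aip Cqj; case: (A i p); case: (B p q); case: (C q j).
Qed.

Lemma rectangle_Emx A (I := [set i | [exists j, A i j == S7_a]])
    (J := [set j | [exists i, A i j == S7_a]]) :
  (forall i j, A i j <> S7_1) ->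
  (forall i j i' j', A i j = S7_a -> A i' j' = S7_a -> A i j' = S7_a) ->
  A = Emx I J.
Proof.
move=> A1 Arect; apply/matrixP => i j; rewrite mxE !inE; case: ifPn.
  by case/andP=> /existsP[j' /eqP Aij'] /existsP[i' /eqP Ai'j]; apply: Arect Aij' Ai'j.
apply: contraNeq => AN; suff Aij : A i j == S7_a.
  by apply/andP; split; apply/existsP; [exists j|exists i].
by move: (A1 i j) AN; case: (A i j).
Qed.

Lemma Emx_oo I J : (I == set0) || (J == set0) -> Emx I J = Cmx n S7_oo.
Proof.
by case/orP=> /eqP->; apply/matrixP => i j; rewrite !mxE !inE ?andbF.
Qed.

(** The outer factors of a product realizing E_{I,J}: the rows of the left one
    indexed by I all equal u, the columns of the right one indexed by J all
    equal v, and oo elsewhere makes the product oo outside of I x J. *)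
Definition rowmx I (u : 'I_n -> S7) : MS7 n :=
  (\matrix_(r, k) if r \in I then u k else S7_oo)%R.

Definition colmx (v : 'I_n -> S7) J : MS7 n :=
  (\matrix_(k, s) if s \in J then v k else S7_oo)%R.

Lemma rowmx_mul_colmx I J u B v :
  (forall p q, S7_mul (S7_mul (u p) (B p q)) (v q) = S7_a) ->
  rowmx I u * B * colmx v J = Emx I J.
Proof.
move=> uBv; apply/matrixP => i j; rewrite [RHS]mxE; have [iI|iI] := boolP (i \in I).
  have [jJ|jJ] := boolP (j \in J).
    by apply/mulg3_entryP => // p q; rewrite !mxE iI jJ.
  by apply: (@mulg_entry_oo _ _ _ _ i); rewrite [colmx _ _ _ _]mxE (negPf jJ); case: (_ i i).
apply: (@mulg_entry_oo _ _ _ _ i); rewrite (@mulg_entry_oo _ _ _ _ i) ?S7_mul0x //.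
by rewrite mxE (negPf iI) S7_mul0x.
Qed.

Definition Eset (P : {set 'I_n} -> {set 'I_n} -> bool) : {set MS7 n} :=
  Cmx n S7_oo |: [set Emx I J | I in [set: {set 'I_n}],
                                J in [set: {set 'I_n}] & P I J].

Lemma EsetP (P : {set 'I_n} -> {set 'I_n} -> bool) A :
  reflect (A = Cmx n S7_oo \/ exists I J, P I J /\ A = Emx I J) (A \in Eset P).
Proof.
apply: (iffP setU1P) => - [->|]; try by left.
  by case/imset2P=> I J _; rewrite !inE => PIJ ->; right; exists I, J.
by case=> I [J [PIJ ->]]; right; apply/imset2P; exists I J; rewrite ?inE.
Qed.

Lemma Npow3E : 1 < n -> Npow n 3 =
  Eset (fun I J => [&& I != set0, J != set0 & (I, J) != ([set: 'I_n], [set: 'I_n])]).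
Proof.
move=> n1; have n0 := ltnW n1; apply/setP => M; apply/idP/EsetP => [|[->|[I [J [IJ ->]]]]].
- rewrite !NpowS Npow1 => /imset2P[_ C /imset2P[A B AN BN ->] CN ->].
  have := rectangle_Emx (fun i j => @mulg3_neq1 A B C i j BN)
                        (fun i j i' j' => mulg3_rectangle BN).
  set I := finset _; set J := finset _ => ABC.
  have [IJ0|] := boolP ((I == set0) || (J == set0)).
    by left; rewrite ABC; exact: Emx_oo.
  rewrite negb_or => /andP[I0 J0]; right; exists I, J; split=> //.
  rewrite I0 J0 /=; apply/eqP => - [IT JT]; apply: (@mulg3_not_a A B C AN CN) => i j.
  by rewrite ABC IT JT mxE !inE.
- exact: Cmx_oo_Npow.
pose i0 := Ordinal n0; pose i1 := Ordinal n1.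
case/and3P: IJ => I0 J0; rewrite xpair_eqE negb_and.
(* The vector with a single a and its complement; as 1 < n, both have an a,
   so that the middle factor and the outer factor built from d lie in N_n
   even when J, respectively I, is full. *)
pose d (k : 'I_n) := if k == i0 then S7_a else S7_1.
pose d' (k : 'I_n) := if k == i0 then S7_1 else S7_a.
rewrite !NpowS Npow1 -!subTset => /orP[/subsetPn[i _ iI]|/subsetPn[j _ jJ]].
  have <- : rowmx I (fun=> S7_1) * (\matrix_(p, q) d' q)%R * colmx d J = Emx I J.
    by apply: rowmx_mul_colmx => p q; rewrite mxE /d /d'; case: eqP.
  do 2?apply: imset2_f; apply/NsetP.
  - by exists i, i0; rewrite mxE (negPf iI).
  - by exists i0, i1; rewrite mxE.
  by case/set0Pn: J0 => j jJ; exists i0, j; rewrite mxE jJ.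
have <- : rowmx I d * (\matrix_(p, q) d' p)%R * colmx (fun=> S7_1) J = Emx I J.
  by apply: rowmx_mul_colmx => p q; rewrite mxE /d /d'; case: eqP.
do 2?apply: imset2_f; apply/NsetP.
- by case/set0Pn: I0 => i iI; exists i, i0; rewrite mxE iI.
- by exists i1, i0; rewrite mxE.
by exists i0, j; rewrite mxE (negPf jJ).
Qed.

(** * The fourth and fifth powers *)

Lemma Emx_setT_mul I B :
  Emx I [set: 'I_n] * B = Emx I [set j | [forall k, B k j == S7_1]].
Proof.
apply/matrixP => i j; rewrite [RHS]mxE inE; case: ifPn => [/andP[iI /forallP Bj]|].
  by apply/mulg_entryP => // k; rewrite mxE iI inE (eqP (Bj k)).
rewrite negb_and => /orP[iI|].
  by apply: (@mulg_entry_oo _ _ _ _ i); rewrite mxE (negPf iI) S7_mul0x.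
rewrite negb_forall => /existsP[k Bkj]; apply: (@mulg_entry_oo _ _ _ _ k).
by rewrite mxE; case: ifP; move: Bkj; case: (B k j).
Qed.

Lemma Emx_mul_oo I J B : J != [set: 'I_n] -> Emx I J * B = Cmx n S7_oo.
Proof.
rewrite -subTset => /subsetPn[k _ kJ].
apply/matrixP => i j; rewrite [RHS]mxE; apply: (@mulg_entry_oo _ _ _ _ k).
by rewrite mxE (negPf kJ) andbF S7_mul0x.
Qed.

Lemma Npow4E : 1 < n -> Npow n 4 =
  Eset (fun I J => [&& I != set0, J != set0,
                       I \proper [set: 'I_n] & J \proper [set: 'I_n]]).
Proof.
move=> n1; have n0 := ltnW n1; apply/setP => M; apply/idP/EsetP => [|[->|[I [J [IJ ->]]]]].
- rewrite NpowS Npow3E // => /imset2P[A B /EsetP[->|[I [J [/and3P[I0 _ IJ] ->]]]] BN ->].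
    by left; exact: Cmx_oo_mul.
  have [JT|/Emx_mul_oo->] := eqVneq J [set: 'I_n]; last by left.
  rewrite JT in IJ *; rewrite Emx_setT_mul; set J' := finset _.
  have [J'0|J'0] := boolP (J' == set0); first by left; rewrite Emx_oo ?J'0 ?orbT.
  right; exists I, J'; split=> //; rewrite I0 J'0 !properT /=; apply/andP; split.
    by apply: contra IJ => /eqP->.
  apply/eqP => /setP J'T; case/NsetP: BN => i [j]; move: (J'T j).
  by rewrite !inE => /forallP/(_ i)/eqP.
- exact: Cmx_oo_Npow.
case/and4P: IJ => I0 J0; rewrite !properT => IT JT.
pose B := colmx (fun=> S7_1) J.
have -> : J = [set j | [forall k, B k j == S7_1]].
  apply/setP => j; rewrite inE; apply/idP/forallP => [jJ k|/(_ (Ordinal n0))].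
    by rewrite mxE jJ.
  by rewrite mxE; case: ifP.
rewrite -Emx_setT_mul NpowS; apply: imset2_f.
  rewrite Npow3E //; apply/EsetP; right; exists I, [set: 'I_n]; split=> //.
  rewrite I0 xpair_eqE negb_and IT /= andbT; apply/set0Pn.
  by exists (Ordinal n0); rewrite inE.
move: JT; rewrite -subTset => /subsetPn[j _ jJ].
by apply/NsetP; exists j, j; rewrite mxE (negPf jJ).
Qed.

Lemma Npow5E : 1 < n -> Npow n 5 = [set Cmx n S7_oo].
Proof.
move=> n1; apply/eqP; rewrite eqEsubset sub1set Cmx_oo_Npow ?(ltnW n1) // andbT.
apply/subsetP => M; rewrite NpowS Npow4E // inE.
case/imset2P => A B /EsetP[->|[I [J [/and4P[_ _ _ JT] ->]]]] _ ->.
  by rewrite Cmx_oo_mul.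
by rewrite Emx_mul_oo // -properT.
Qed.

(** * Nilpotency *)

Lemma sgprod_val (s : seq (Nsub n)) :
  sgprod (map val s) = omap val (sgprod s).
Proof.
case: s => //= x s; congr Some.
by elim: s x => //= y s IH x; rewrite -IH.
Qed.

(** Products in the subsemigroup N_n are the products of matrices that all lie
    in N_n, which transfers nilpotency of the subtype to its powers as sets. *)
Lemma Npow_valP k A : reflect
  (exists t : k.-tuple (Nsub n), omap val (sgprod t) = Some A) (A \in Npow n k).
Proof.
apply: (iffP (NpowP k A)) => [[s [sk sN sA]]|[t tA]]; last first.
  exists (map val t); rewrite size_map size_tuple sgprod_val; split=> //.
  by apply/allP => _ /mapP[x _ ->]; exact: valP.
have [s' def_s] : exists s' : seq (Nsub n), map val s' = s.
  elim: s sN {sk sA} => [|x s IH] /=; first by exists [::].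
  by case/andP=> xN /IH[s' <-]; exists ((exist _ x xN : Nsub n) :: s').
have s'k : size s' == k by rewrite -sk -def_s size_map.
by exists (Tuple s'k); rewrite -sgprod_val /= def_s.
Qed.

(** A zero is unique, so the zero witnessing nilpotency must be the constant
    matrix oo; and this matrix is itself a product of k.+1 elements of N_n. *)
Lemma nilpotent_sgP k : 0 < n ->
  nilpotent_sg (Nsub n) k.+1 <-> Npow n k.+1 = [set Cmx n S7_oo].
Proof.
move=> n0; pose z0 : Nsub n := exist _ (Cmx n S7_oo) (Cmx_oo_Nset n0).
have z00 : is_zero z0.
  by move=> x; split; apply: val_inj; [exact: Cmx_oo_mul|exact: mul_Cmx_oo].
split=> [[z zz zk]|Nk]; last first.
  exists z0 => // t; case tA: (sgprod t) => [x|]; last first.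
    by case/tupleP: t tA.
  congr Some; apply: val_inj; apply/set1P; rewrite -Nk.
  by apply/Npow_valP; exists t; rewrite tA.
have zE : z = z0 by rewrite -(zz z0).1 (z00 z).2.
apply/eqP; rewrite eqEsubset sub1set Cmx_oo_Npow // andbT; apply/subsetP => A.
by case/Npow_valP=> t; rewrite zk zE => - [<-]; rewrite inE.
Qed.

(** * Cardinalities *)

Lemma Emx_inj (I J I' J' : {set 'I_n}) : I != set0 -> J != set0 ->
  Emx I J = Emx I' J' -> (I, J) = (I', J').
Proof.
case/set0Pn=> i0 i0I /set0Pn[j0 j0J] E.
have EP i j : (i \in I) && (j \in J) = (i \in I') && (j \in J').
  by move/matrixP/(_ i j): E; rewrite !mxE; do 2!case: ifP.
have /andP[i0I' j0J'] : (i0 \in I') && (j0 \in J') by rewrite -EP i0I.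
congr pair; apply/setP => k.
  by move: (EP k j0); rewrite j0J j0J' !andbT.
by move: (EP i0 k); rewrite i0I i0I'.
Qed.

Lemma card_Emx (P : {set 'I_n} -> {set 'I_n} -> bool) :
  (forall I J, P I J -> (I != set0) && (J != set0)) ->
  #|Eset P| = #|[set p | P p.1 p.2]|.+1.
Proof.
move=> P0; rewrite /Eset; set S := imset2 _ _ _.
have -> : S = [set Emx p.1 p.2 | p in [set p | P p.1 p.2]].
  apply/setP => A; apply/imset2P/imsetP => [[I J _]|[[I J]]]; rewrite !inE /=.
    by move=> PIJ ->; exists (I, J); rewrite ?inE.
  by move=> PIJ ->; exists I J; rewrite ?inE.
rewrite cardsU1 card_in_imset => [|[I J] [I' J'] /=]; last first.
  by rewrite !inE /= => /P0/andP[I0 J0] _; exact: Emx_inj.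
rewrite (_ : _ \notin _) //; apply/imsetP => - [[I J]].
rewrite inE /= => /P0/andP[/set0Pn[i iI] /set0Pn[j jJ]] /matrixP/(_ i j).
by rewrite !mxE iI jJ.
Qed.

End Products.

Lemma card_set_ord n : #|{set 'I_n}| = 2 ^ n.
Proof. by rewrite -cardsT -powersetT card_powerset cardsT card_ord. Qed.

Lemma card_Npow3 n : 1 < n -> #|Npow n 3| = (2 ^ n - 1) ^ 2.
Proof.
move=> n1; rewrite Npow3E // card_Emx => [|I J /and3P[-> ->] //].
set D := finset _.
have -> : D = setX [set~ set0] [set~ set0] :\ ([set: 'I_n], [set: 'I_n]).
  by apply/setP => - [I J]; rewrite !inE /=; case: (I != _); case: (J != _);
    rewrite ?andbT ?andbF.
have T0 : [set: 'I_n] != set0 by apply/set0Pn; exists (Ordinal (ltnW n1)); rewrite inE.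
have := cardsD1 ([set: 'I_n], [set: 'I_n]) (setX [set~ set0] [set~ set0]).
rewrite !inE T0 /= add1n => <-.
by rewrite cardsX cardsC1 card_set_ord subn1 mulnn.
Qed.

Lemma card_Npow4 n : 1 < n -> #|Npow n 4| = (2 ^ n - 2) ^ 2 + 1.
Proof.
move=> n1; rewrite Npow4E // card_Emx => [|I J /and4P[-> ->] //].
pose S : {set {set 'I_n}} := ~: [set set0; [set: 'I_n]].
rewrite addn1; congr _.+1; set D := finset _.
have -> : D = setX S S.
  apply/setP => - [I J]; rewrite !inE !negb_or /= !properT.
  by case: (I != set0); case: (J != set0); rewrite ?andbF.
have T0 : set0 != [set: 'I_n].
  by rewrite eq_sym; apply/set0Pn; exists (Ordinal (ltnW n1)); rewrite inE.
by rewrite cardsX cardsCs setCK cards2 T0 card_set_ord mulnn.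
Qed.

Theorem theorem8p1 (n : nat) (hn : 2 <= n) :
  [/\ Npow n 3 = Cmx n S7_oo |:
        [set Emx I J | I in [set: {set 'I_n}], J in [set: {set 'I_n}]
           & [&& I != set0, J != set0 & (I, J) != ([set: 'I_n], [set: 'I_n])]],
      Npow n 4 = Cmx n S7_oo |:
        [set Emx I J | I in [set: {set 'I_n}], J in [set: {set 'I_n}]
           & [&& I != set0, J != set0,
                 I \proper [set: 'I_n] & J \proper [set: 'I_n]]]
    & Npow n 5 = [set Cmx n S7_oo]] /\
  [/\ #|Npow n 3| = (2 ^ n - 1) ^ 2 &
      #|Npow n 4| = (2 ^ n - 2) ^ 2 + 1] /\
  [/\ nilpotent_sg (Nsub n) 5 & ~ nilpotent_sg (Nsub n) 4].
Proof.
have n0 := ltnW hn; split; first by rewrite Npow3E // Npow4E // Npow5E.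
split; first by rewrite card_Npow3 ?card_Npow4.
split=> [|/(nilpotent_sgP _ n0) N4]; first by apply/nilpotent_sgP => //; exact: Npow5E.
(* If N_n were 4-nilpotent, its fourth power would have a single element. *)
have := card_Npow4 hn; rewrite N4 cards1 addn1 => - [/esym/eqP].
rewrite expn_eq0 andbT subn_eq0 leqNgt => /negP; apply.
by rewrite -{1}(expn1 2) ltn_exp2l.
Qed.
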